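(* For all positive integers $n,p$, $$\Omega\left(\mathtt{DP}(n,p)\right)\le \mathtt{SPO}(n,p)\le O\left(\mathtt{DP}(n,p)\log n\right).$$
   Context: For a directed graph $G=(V,E,w)$ with nonnegative real edge weights and a set $P\subseteq V\times V$ of demand pairs, a distance preserver is a subgraph $H\subseteq G$ with $\mathrm{dist}_H(s,t)=\mathrm{dist}_G(s,t)$ for all $(s,t)\in P$; $\mathtt{DP}(n,p)$ is the least integer such that every $n$-node such graph and every set of $|P|=p$ demand pairs has a distance preserver on at most $\mathtt{DP}(n,p)$ edges. A shortest path oracle for $G,P$ is a data structure (a bit string, together with a fixed decoding procedure) that, when queried with any $(s,t)\in P$, reports a shortest $s\leadsto t$ path in $G$ (or ''no path'' if none exists). $\mathtt{SPO}(n,p)$ is the smallest integer such that every $n$-node graph and set of $|P|=p$ demand pairs has a shortest path oracle on at most $\mathtt{SPO}(n,p)$ bits. *)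

(* Defs.v *)
From HB Require Import structures.
From mathcomp Require Import all_boot all_order all_algebra.
From mathcomp Require Import all_classical all_reals.
From mathcomp Require Import ereal exp.
Set Implicit Arguments. Unset Strict Implicit. Unset Printing Implicit Defensive.
Import Order.TTheory GRing.Theory Num.Theory.
Local Open Scope classical_set_scope.
Local Open Scope ring_scope.

Section Defs.
Variable R : realType.

(* A directed graph on vertex set 'I_n is given by an edge set
   E : {set 'I_n * 'I_n} and a weight function w (only its values on E matter). *)
Definition nonneg_weights n (E : {set 'I_n * 'I_n}) (w : 'I_n * 'I_n -> R) :=
  forall e, e \in E -> 0 <= w e.

Definition is_path n (E : {set 'I_n * 'I_n}) (s t : 'I_n) (q : seq 'I_n) : bool :=
  if q is x :: r then
    [&& x == s, path (fun a b => (a, b) \in E) x r, last x r == t & uniq q]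
  else false.

Definition pweight n (w : 'I_n * 'I_n -> R) (q : seq 'I_n) : R :=
  \sum_(e <- zip q (behead q)) w e.

(* dist(s,t) in (E,w), as an extended real; +oo if there is no path. *)
Definition dist n (E : {set 'I_n * 'I_n}) (w : 'I_n * 'I_n -> R) (s t : 'I_n)
  : \bar R :=
  ereal_inf [set (pweight w q)%:E | q in [set q | is_path E s t q]].

Definition distance_preserver n (E EH : {set 'I_n * 'I_n})
  (w : 'I_n * 'I_n -> R) (P : {set 'I_n * 'I_n}) :=
  EH \subset E /\ forall st, st \in P -> dist EH w st.1 st.2 = dist E w st.1 st.2.

Definition DP_ok (n p k : nat) : Prop :=
  forall (E : {set 'I_n * 'I_n}) (w : 'I_n * 'I_n -> R), nonneg_weights E w ->
  forall P : {set 'I_n * 'I_n}, #|P| = p ->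
  exists EH : {set 'I_n * 'I_n}, distance_preserver E EH w P /\ (#|EH| <= k)%N.

Definition correct_answer n (E : {set 'I_n * 'I_n}) (w : 'I_n * 'I_n -> R)
  (s t : 'I_n) (ans : option (seq 'I_n)) : Prop :=
  match ans with
  | None => forall q, ~~ is_path E s t q
  | Some q => is_path E s t q /\ (pweight w q)%:E = dist E w s t
  end.

(* b is an admissible bound in the definition of SPO(n,p): there is a fixed
   decoding procedure D (depending only on n and p) such that every n-node
   graph and every set of p demand pairs admits a bit string of at most b
   bits from which D answers every query in P correctly. *)
Definition SPO_ok (n p b : nat) : Prop :=
  exists D : bitseq -> 'I_n -> 'I_n -> option (seq 'I_n),
  forall (E : {set 'I_n * 'I_n}) (w : 'I_n * 'I_n -> R), nonneg_weights E w ->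
  forall P : {set 'I_n * 'I_n}, #|P| = p ->
  exists bs : bitseq, (size bs <= b)%N /\
    forall s t, (s, t) \in P -> correct_answer E w s t (D bs s t).

(* Least natural number satisfying Q (0 if none exists; for DP and SPO a
   bound always exists, so this fallback is never used). *)
Definition least_nat (Q : nat -> Prop) : nat :=
  match pselect (exists k, Q k) with
  | left h =>
      @ex_minn (fun k => `[< Q k >])
        (let: ex_intro k hk := h in ex_intro _ k (asboolT hk))
  | right _ => 0%N
  end.

Definition DP (n p : nat) : nat := least_nat (DP_ok n p).
Definition SPO (n p : nat) : nat := least_nat (SPO_ok n p).

End Defs.

(* Main.v *)
Require Import Defs.
From HB Require Import structures.
From mathcomp Require Import all_boot all_order all_algebra.
From mathcomp Require Import all_classical all_reals.
From mathcomp Require Import ereal exp.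
From mathcomp Require Import lra zify.
Import Order.TTheory GRing.Theory Num.Theory.
Local Open Scope ring_scope.

(**
Perturb the weights, giving non-edges a huge weight, so that any two nodes are
joined by a unique shortest path.  Process the demand pairs that have a path in
some order, and describe each shortest path by a chain of its nodes, consecutive
nodes being joined by an edge or lying, in this order, on an earlier shortest
path.  The chains determine all the paths, so their total length N bounds both
the size of a preserver and, up to a factor O(log n), the size of an oracle.
Dropping superfluous nodes, one may assume that two nodes at distance two in a
chain never lie on an earlier shortest path; keeping every second node then
gives chains none of whose steps is covered by an earlier path.

Take the steps of these coarser chains as the edges of a new graph, weighted by
distance minus a tiny discount that grows fast with the index of the chain: each
chain becomes the unique shortest path between its ends.  Hence DP is at least
the total number of steps.  The same holds for every choice of subsequences with
the same ends, and an oracle has to tell all these choices apart, so SPO is at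
least about the number of interior nodes.  Both quantities are also of order at
least p, by unit weighted graphs whose edges are demand pairs, and hence
N = O(DP) and N = O(SPO).
*)
Set Implicit Arguments.
Unset Strict Implicit.
Unset Printing Implicit Defensive.

(** Locked so that simplification leaves it alone; unlocked, it is the index sequence of the sum in
    [pweight]. *)
HB.lock Definition edges (T : Type) (q : seq T) : seq (T * T) := zip q (behead q).

(** * Edges of sequences and simple paths *)

Section Sequences.
Variable T : eqType.
Implicit Types (x y z : T) (q r : seq T).

Lemma edges_cons x y r : edges [:: x, y & r] = (x, y) :: edges (y :: r).
Proof. by rewrite edges.unlock. Qed.

Lemma edges1 x : edges [:: x] = [::].
Proof. by rewrite edges.unlock. Qed.

Lemma size_edges x r : size (edges (x :: r)) = size r.
Proof. by elim: r x => [|y r IH] x; rewrite ?edges1 ?edges_cons //= IH. Qed.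

Lemma edges_cat x r1 r2 :
  edges (x :: r1 ++ r2) = edges (x :: r1) ++ edges (last x r1 :: r2).
Proof. by elim: r1 x => [|y r1 IH] x /=; rewrite ?edges1 ?edges_cons ?IH. Qed.

Lemma mem_edges x r e :
  e \in edges (x :: r) -> e.1 \in x :: r /\ e.2 \in r.
Proof.
elim: r x => [|y r IH] x; rewrite ?edges1 // edges_cons inE => /predU1P [-> | /IH].
  by split; rewrite !inE eqxx.
by case=> e1 e2; split; apply/orP; right.
Qed.

Lemma edges_uniq x r : uniq (x :: r) -> uniq (edges (x :: r)).
Proof.
elim: r x => [|y r IH] x; rewrite ?edges1 // => /= /andP [xr ur].
rewrite edges_cons cons_uniq IH // andbT.
by apply/negP => /mem_edges [/= xyr _]; rewrite xyr in xr.
Qed.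

Lemma edges_neq x r e : uniq (x :: r) -> e \in edges (x :: r) -> e.1 != e.2.
Proof.
elim: r x => [|y r IH] x; rewrite ?edges1 // => /= /andP [xr ur].
rewrite edges_cons inE => /predU1P [-> | /IH -> //].
by apply: contraNneq xr => /= ->; rewrite mem_head.
Qed.

Lemma edges_split x r e : e \in edges (x :: r) ->
  exists r1 r2, r = r1 ++ e.2 :: r2 /\ last x r1 = e.1.
Proof.
elim: r x => [|y r IH] x; rewrite ?edges1 // edges_cons inE => /predU1P [-> | ] /=.
  by exists [::], r.
by move=> /IH [r1 [r2 [-> <-]]]; exists (y :: r1), r2.
Qed.

(** A simple path from [x] leaves [x] only by its first edge, so both paths start with the same
    edge, and the inclusion then passes to the tails. *)
Lemma simple_path_sub_eq x r r' : uniq (x :: r) -> uniq (x :: r') ->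
  last x r = last x r' -> {subset edges (x :: r) <= edges (x :: r')} -> r = r'.
Proof.
elim: r x r' => [|y r IH] x [|y' r'] //=.
- by move=> _ /andP [xr _] xE; rewrite xE mem_last in xr.
- by move=> _ _ _ /(_ (x, y)); rewrite edges_cons edges1 mem_head => /(_ isT).
move=> /andP [xr ur] /andP [xr' ur'] lE sub.
have yE : y = y'.
  have := sub (x, y); rewrite edges_cons mem_head => /(_ isT).
  rewrite edges_cons inE => /predU1P [[] // |] /mem_edges [/=].
  by rewrite (negPf xr').
rewrite -yE in xr' ur' lE sub *; congr cons; apply: (IH y) => // e er.
have /sub : e \in edges [:: x, y & r] by rewrite edges_cons in_cons er orbT.
rewrite edges_cons inE => /predU1P [eE | //]; move/mem_edges: er.
by rewrite eE /= (negPf xr) => -[].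
Qed.

Lemma infix_edges q r : infix q r -> {subset edges q <= edges r}.
Proof.
move=> /infixP [a [b ->]] {r} e; case: q => [|x q]; first by rewrite edges.unlock.
move=> eq.
have -> : a ++ (x :: q) ++ b = rcons a x ++ (q ++ b) by rewrite cat_rcons.
case: a => [|y a] /=.
  by rewrite edges_cat mem_cat eq.
by rewrite !edges_cat !mem_cat last_rcons eq !orbT.
Qed.

Lemma count_lt_size (A s : seq T) : uniq s -> ~~ all (mem s) A ->
  (count (mem A) s < size A)%N.
Proof.
move=> us /allPn [e eA es]; rewrite -size_filter.
have -> : size A = (size (rem e A)).+1 by rewrite size_rem // prednK //; case: A eA.
rewrite ltnS uniq_leq_size ?filter_uniq // => f; rewrite mem_filter => /andP [fA fs].
have : f \in e :: rem e A by rewrite -(perm_mem (perm_to_rem eA)).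
by rewrite inE => /predU1P [fE|//]; case/negP: es; rewrite -fE.
Qed.

End Sequences.

(** * Path weights, distances and unique shortest paths *)

Section PathWeights.
Variables (R : realType) (n : nat).
Implicit Types (w : 'I_n * 'I_n -> R) (E : {set 'I_n * 'I_n}).
Implicit Types (x y z s t : 'I_n) (q r : seq 'I_n).

Lemma pweightE w q : pweight w q = \sum_(e <- edges q) w e.
Proof. by rewrite edges.unlock. Qed.

Lemma pweight1 w x : pweight w [:: x] = 0.
Proof. by rewrite pweightE edges1 big_nil. Qed.

Lemma pweight_cons w x y r :
  pweight w [:: x, y & r] = w (x, y) + pweight w (y :: r).
Proof. by rewrite !pweightE edges_cons big_cons. Qed.

Lemma pweight_cat w x r1 r2 :
  pweight w (x :: r1 ++ r2) = pweight w (x :: r1) + pweight w (last x r1 :: r2).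
Proof. by rewrite !pweightE edges_cat big_cat. Qed.

Lemma pweightD w1 w2 q :
  pweight (fun e => w1 e + w2 e) q = pweight w1 q + pweight w2 q.
Proof. by rewrite !pweightE big_split. Qed.

Lemma pweightZ a w q : pweight (fun e => a * w e) q = a * pweight w q.
Proof. by rewrite !pweightE mulr_sumr. Qed.

Lemma eq_pweight w1 w2 q : {in edges q, w1 =1 w2} -> pweight w1 q = pweight w2 q.
Proof. by move=> w12; rewrite !pweightE; apply: eq_big_seq. Qed.

Lemma pweight_ge0 w q : {in edges q, forall e, 0 <= w e} -> 0 <= pweight w q.
Proof. by move=> w0; rewrite pweightE big_seq sumr_ge0. Qed.

Lemma is_pathP E s t q : reflect
  (exists r, [/\ q = s :: r, uniq (s :: r), last s r = t &
    {subset edges (s :: r) <= E}]) (is_path E s t q).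
Proof.
have pathE x r : path (fun a b => (a, b) \in E) x r = all (mem E) (edges (x :: r)).
  by elim: r x => [|y r IH] x; rewrite ?edges1 ?edges_cons //= IH.
case: q => [|x r] /=; first by apply: (iffP idP) => // -[] r [].
apply: (iffP and4P) => [[/eqP <- pr /eqP lr ur]|[r' [[<- <-] ur lr sub]]].
  by exists r; split=> // e er; move: pr; rewrite pathE => /allP; apply.
by split; rewrite ?lr // pathE; apply/allP.
Qed.

Lemma uniq_size_le q : uniq q -> (size q <= n)%N.
Proof. by move=> uq; rewrite -[X in (_ <= X)%N]card_ord -(card_uniqP uq) max_card. Qed.

(** Sequences without repetition have at most [n] entries, so they live in a finite type. *)
Lemma simple_argmin (Q : pred (seq 'I_n)) (f : seq 'I_n -> R) q0 :
  (forall q, Q q -> uniq q) -> Q q0 ->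
  exists2 q, Q q & forall q', Q q' -> f q <= f q'.
Proof.
move=> Qu Qq0.
pose b0 : n.-bseq 'I_n := Bseq (uniq_size_le (Qu _ Qq0)).
case: (@arg_minP _ _ _ b0 (fun q : n.-bseq 'I_n => Q q)
  (fun q : n.-bseq 'I_n => f q) Qq0) => q Qq qmin.
by exists q => // q' Qq'; apply: (qmin (Bseq (uniq_size_le (Qu _ Qq')))).
Qed.

Lemma dist_cases E w s t :
  (forall q, ~~ is_path E s t q) /\ dist E w s t = +oo%E \/
  exists q, [/\ is_path E s t q, dist E w s t = (pweight w q)%:E &
    forall q', is_path E s t q' -> pweight w q <= pweight w q'].
Proof.
have [[q0 q0P]|noq] := pselect (exists q, is_path E s t q); last first.
  left; split=> [q|]; first by apply/negP => qP; apply: noq; exists q.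
  rewrite /dist (_ : [set _ | _ in _]%classic = set0) ?ereal_inf0 //.
  by rewrite -subset0 => x [q qP _]; apply: noq; exists q.
right; have [|q qP qmin] := @simple_argmin (is_path E s t) (pweight w) q0 _ q0P.
  by move=> q /is_pathP [r [-> ]].
exists q; split=> //; apply/eqP; rewrite eq_le; apply/andP; split.
  by apply: ereal_inf_lbound; exists q.
by apply: le_ereal_inf_tmp => _ [q' q'P <-]; rewrite lee_fin qmin.
Qed.

Lemma dist_min E w s t q : is_path E s t q ->
  (forall q', is_path E s t q' -> pweight w q <= pweight w q') ->
  dist E w s t = (pweight w q)%:E.
Proof.
move=> qP qmin; have [[noq _]|[q' [q'P -> q'min]]] := dist_cases E w s t.
  by rewrite (negPf (noq q)) in qP.
by congr _%:E; apply/eqP; rewrite eq_le q'min // qmin.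
Qed.

Definition unique_shortest E w s t q : Prop :=
  is_path E s t q /\
  forall q', is_path E s t q' -> q' != q -> pweight w q < pweight w q'.

Lemma unique_shortest_dist E w s t q : unique_shortest E w s t q ->
  dist E w s t = (pweight w q)%:E.
Proof.
case=> qP qmin; apply: dist_min => // q' q'P.
by have [->|/(qmin _ q'P)/ltW] := eqVneq q' q.
Qed.

Lemma unique_shortest_answer E w s t q ans : unique_shortest E w s t q ->
  correct_answer E w s t ans -> ans = Some q.
Proof.
move=> qu; case: ans => [q'|] /=; last by move=> /(_ q); rewrite (proj1 qu).
rewrite (unique_shortest_dist qu) => -[q'P [wE]]; congr Some; apply/eqP.
by apply/negPn/negP => /(proj2 qu _ q'P); rewrite wE ltxx.
Qed.

(** The distance in [EH] is attained by a path of [EH], which is also a path of [E] and hence,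
    having minimal weight there, equals [q]. *)
Lemma unique_shortest_preserved E EH w (P : {set 'I_n * 'I_n}) s t q :
  distance_preserver E EH w P -> (s, t) \in P ->
  unique_shortest E w s t q -> is_path EH s t q.
Proof.
move=> [/fintype.subsetP sub dP] /dP /= dE qu.
have [[_]|[q' [q'H]]] := dist_cases EH w s t.
  by rewrite dE (unique_shortest_dist qu).
rewrite dE (unique_shortest_dist qu) => -[wE] _.
have q'E : is_path E s t q'.
  case/is_pathP: q'H => r [-> ur lr subr]; apply/is_pathP.
  by exists r; split=> // e /subr /sub.
have [<-//|/(proj2 qu _ q'E)] := eqVneq q' q.
by rewrite wE ltxx.
Qed.

(* Adding a sufficiently small multiple of [g] only breaks ties of [f]. *)
Lemma tie_breaking (f g : seq 'I_n -> R) : exists2 eps : R, 0 < eps &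
  forall q q', uniq q -> uniq q' -> f q < f q' -> f q + eps * g q < f q' + eps * g q'.
Proof.
pose T := (n.-bseq 'I_n * n.-bseq 'I_n)%type.
(* A positive [eps] up to this ratio keeps the strict order for the pair [p]; the summand 1 keeps
   the denominator positive. There are finitely many pairs, so half the minimum serves them all. *)
pose eps1 (p : T) := if f (bseqval p.1) < f (bseqval p.2) then
  (f (bseqval p.2) - f (bseqval p.1)) / (1 + `|g (bseqval p.1) - g (bseqval p.2)|) else 1.
have eps1_gt0 p : 0 < eps1 p.
  rewrite /eps1; case: ifP => [fp|_]; last exact: ltr01.
  by rewrite divr_gt0 ?subr_gt0 // ltr_pwDl.
case: (@arg_minP _ _ _ (([bseq], [bseq]) : T) predT eps1 isT) => p _ pmin.
exists (eps1 p / 2); first by rewrite divr_gt0.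
move=> q q' uq uq' fq.
have := pmin (Bseq (uniq_size_le uq), Bseq (uniq_size_le uq')) isT.
have N1 : 0 < 1 + `|g q - g q'| by rewrite ltr_pwDl.
rewrite [X in _ <= X]/eps1 /= fq ler_pdivlMr //.
have := eps1_gt0 p; have := ler_norm (g q - g q'); have := normr_ge0 (g q - g q').
move: (eps1 p) `|_| => e N N0 gN e0 eN.
have h1 : 0 <= e * (N - (g q - g q')) by rewrite mulr_ge0 ?subr_ge0 // ltW.
have h2 : 0 <= e * N by rewrite mulr_ge0 // ltW.
nra.
Qed.

End PathWeights.

(** * Metric properties of unique geodesics *)

Section Geodesics.
Variables (R : realType) (n : nat).
Variables (W : 'I_n * 'I_n -> R) (geo : 'I_n -> 'I_n -> seq 'I_n).
Implicit Types (s t u v x y z : 'I_n) (q r : seq 'I_n) (e : 'I_n * 'I_n).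

(* The path from [x] to [z] is [x :: geo x z]. *)
Definition unique_geodesics : Prop :=
  [/\ forall e, 0 < W e,
      forall x z, uniq (x :: geo x z),
      forall x z, last x (geo x z) = z &
      forall x r, uniq (x :: r) -> r != geo x (last x r) ->
        pweight W (x :: geo x (last x r)) < pweight W (x :: r)].

(** The distance in the complete digraph weighted by [W]; it takes a pair so that it can itself be
    the weight in [pweight]. *)
Definition gdist e : R := pweight W (e.1 :: geo e.1 e.2).

(** By the triangle inequality this is an equality: [e.1] and [e.2] lie in this order on the
    geodesic from [s] to [t]. *)
Definition covers s t e : bool :=
  gdist (s, e.1) + gdist e + gdist (e.2, t) <= gdist (s, t).

Hypothesis geoP : unique_geodesics.

Let W_gt0 e : 0 < W e. Proof. by case: geoP. Qed.
Let geo_uniq x z : uniq (x :: geo x z). Proof. by case: geoP. Qed.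
Let geo_last x z : last x (geo x z) = z. Proof. by case: geoP. Qed.

Lemma gdist_ge0 e : 0 <= gdist e.
Proof. by apply: pweight_ge0 => ? _; apply: ltW. Qed.

Lemma geo_lt x r : uniq (x :: r) -> r != geo x (last x r) ->
  gdist (x, last x r) < pweight W (x :: r).
Proof. by case: geoP => _ _ _; apply. Qed.

Lemma geo_refl x : geo x x = [::].
Proof.
apply/eqP; rewrite eq_sym; apply/negPn/negP => /(@geo_lt x [::] isT) /=.
by rewrite pweight1 ltNge gdist_ge0.
Qed.

Lemma gdist_refl x : gdist (x, x) = 0.
Proof. by rewrite /gdist /= geo_refl pweight1. Qed.

Lemma gdist_gt0 x y : x != y -> 0 < gdist (x, y).
Proof.
rewrite /gdist /=; have := geo_last x y.
case: (geo x y) => [/= ->|z r _ _]; first by rewrite eqxx.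
rewrite pweight_cons ltr_pwDl //; apply: pweight_ge0 => e _; exact: ltW.
Qed.

Lemma gdist_simple x r : uniq (x :: r) ->
  gdist (x, last x r) <= pweight W (x :: r).
Proof.
move=> u; have [rE|/(geo_lt u)/ltW //] := eqVneq r (geo x (last x r)).
by rewrite /gdist /= -rE.
Qed.

(** If [x] lies on the geodesic from [y] to [z], its final segment from [x] is strictly cheaper than
    the detour through [y]. Otherwise prepending [x] gives a simple path, and uniqueness settles the
    case of equality. *)
Lemma gdist_step x y z : gdist (x, z) <= W (x, y) + gdist (y, z) /\
  (W (x, y) + gdist (y, z) <= gdist (x, z) -> geo x z = y :: geo y z).
Proof.
have [xin|xnin] := boolP (x \in y :: geo y z).
  suff lt : gdist (x, z) < W (x, y) + gdist (y, z).
    by split; [exact: ltW | rewrite leNgt lt].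
  have [r1 [r2 rE]] : exists r1 r2, y :: geo y z = r1 ++ x :: r2.
    by case/splitPr: xin => r1 r2; exists r1, r2.
  have lE : last x r2 = z.
    by have := geo_last y z; rewrite -[last y _]/(last y (y :: _)) rE last_cat.
  have u : uniq (x :: r2).
    by have := geo_uniq y z; rewrite rE cat_uniq => /and3P [].
  apply: (@le_lt_trans _ _ (gdist (y, z))); last by rewrite ltrDr.
  rewrite -{1}lE; apply: (le_trans (gdist_simple u)).
  rewrite /gdist /= rE; case: r1 rE => [|y' r1] //= [_ _].
  rewrite pweight_cat pweight_cons addrA lerDr addr_ge0 ?(ltW (W_gt0 _)) //.
  by apply: pweight_ge0 => e _; apply: ltW.
have u : uniq (x :: y :: geo y z) by rewrite cons_uniq xnin geo_uniq.
have l : last x (y :: geo y z) = z by exact: geo_last.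
have pE : pweight W (x :: y :: geo y z) = W (x, y) + gdist (y, z).
  by rewrite pweight_cons.
split; first by have := gdist_simple u; rewrite l pE.
have := geo_lt u; rewrite l pE => lt le.
by apply/eqP; rewrite eq_sym; apply: contraLR le => /lt; rewrite -ltNge.
Qed.

Lemma gdist_walk x r : gdist (x, last x r) <= pweight W (x :: r).
Proof.
elim: r x => [|y r IH] x; first by rewrite gdist_refl pweight1.
rewrite pweight_cons /=; have [step _] := gdist_step x y (last y r).
by apply: (le_trans step); rewrite lerD2l.
Qed.

(** A walk as short as the distance has equality in every use of [gdist_step], so simplicity need
    not be assumed. *)
Lemma walk_geo x r :
  pweight W (x :: r) <= gdist (x, last x r) -> r = geo x (last x r).
Proof.
elim: r x => [|y r IH] x; first by rewrite geo_refl.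
rewrite pweight_cons /=; have [step stepE] := gdist_step x y (last y r).
have walk := gdist_walk y r => le.
by rewrite stepE -?IH //; lra.
Qed.

Lemma gdist_triangle x y z : gdist (x, z) <= gdist (x, y) + gdist (y, z).
Proof.
have := gdist_walk x (geo x y ++ geo y z).
by rewrite last_cat !geo_last pweight_cat geo_last.
Qed.

Lemma geo_cat x y z : gdist (x, y) + gdist (y, z) <= gdist (x, z) ->
  geo x z = geo x y ++ geo y z.
Proof.
have := @walk_geo x (geo x y ++ geo y z).
by rewrite last_cat !geo_last pweight_cat geo_last => wg /wg.
Qed.

Lemma covers_geo s t e : covers s t e ->
  geo s t = geo s e.1 ++ geo e.1 e.2 ++ geo e.2 t.
Proof.
case: e => u v; rewrite /covers /= => c.
have tr1 := gdist_triangle s u t; have tr2 := gdist_triangle u v t.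
by rewrite (@geo_cat s u t) ?(@geo_cat u v t) //; lra.
Qed.

Lemma covers_infix s t u v : covers s t (u, v) ->
  infix (u :: geo u v) (s :: geo s t).
Proof.
move=> /covers_geo ->; rewrite -cat_cons (lastI s) geo_last cat_rcons.
exact: infix_infix.
Qed.

(** A shortcut for the segment would shorten the whole geodesic. With [covers_infix] this identifies
    covered pairs with the ends of segments. *)
Lemma infix_geo s t u r : infix (u :: r) (s :: geo s t) ->
  r = geo u (last u r) /\ covers s t (u, last u r).
Proof.
move=> /infixP [a [c gE]]; set v := last u r.
have [b [bE lb]] : exists b, geo s t = b ++ r ++ c /\ last s b = u.
  case: a gE => [|y a] /= [-> ->]; first by exists [::].
  by exists (rcons a u); rewrite cat_rcons last_rcons.
have wE : gdist (s, t) =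
    pweight W (s :: b) + pweight W (u :: r) + pweight W (v :: c).
  by rewrite /gdist /= bE !pweight_cat lb addrA.
have lc : last v c = t by rewrite -(geo_last s t) bE !last_cat lb.
have w1 := gdist_walk s b; have w2 := gdist_walk v c; have w3 := gdist_walk u r.
rewrite lb in w1; rewrite lc in w2; rewrite -/v in w3.
have tr1 := gdist_triangle s u t; have tr2 := gdist_triangle u v t.
by rewrite /covers /=; split; [apply: walk_geo; rewrite -/v | ]; lra.
Qed.

Lemma gdist_chain x r : gdist (x, last x r) <= pweight gdist (x :: r).
Proof.
elim: r x => [|y r IH] x; first by rewrite gdist_refl pweight1.
rewrite pweight_cons /=; apply: (le_trans (gdist_triangle x y _)).
by rewrite lerD2l.
Qed.

(** The reverse inequality is [gdist_chain]; equality means that the nodes lie in this order on the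
    geodesic between the ends. *)
Definition tight x r : bool := pweight gdist (x :: r) <= gdist (x, last x r).

Lemma tight_geo x z : tight x (geo x z).
Proof.
rewrite /tight -{2}/(gdist (x, last x (geo x z))).
suff sub q : infix q (x :: geo x z) -> pweight gdist q = pweight W q.
  by rewrite sub ?infix_refl // geo_last.
move=> qi; apply: eq_pweight => -[u v] /= uv.
case: q qi uv => [|y r] qi; first by rewrite edges.unlock.
move=> /edges_split [/= r1 [r2 [rE lr]]].
have : infix [:: u; v] (x :: geo x z).
  apply: infix_trans qi; rewrite rE -cat_cons (lastI y) lr cat_rcons.
  exact: (@infix_infix _ _ [:: u; v] r2).
by move=> /infix_geo [/= gE _]; rewrite /gdist /= -gE pweight_cons pweight1 addr0.
Qed.

Lemma tight_cons x y r : tight x (y :: r) ->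
  tight y r /\ gdist (x, y) + gdist (y, last y r) <= gdist (x, last y r).
Proof.
rewrite /tight pweight_cons /= => tg.
have tr := gdist_triangle x y (last y r); have ch := gdist_chain y r.
by split; lra.
Qed.

Lemma tight_covers x r e : tight x r -> e \in edges (x :: r) ->
  covers x (last x r) e.
Proof.
elim: r x => [|y r IH] x; first by rewrite edges1.
move=> /tight_cons [tg le]; rewrite edges_cons inE /= => /predU1P [-> | er].
  by rewrite /covers /= gdist_refl add0r.
have := IH _ tg er; rewrite /covers; have := gdist_triangle x y e.1; lra.
Qed.

Lemma subseq_chain x r' r : subseq r' r -> last x r' = last x r ->
  pweight gdist (x :: r') <= pweight gdist (x :: r).
Proof.
elim: r x r' => [|y r IH] x [|y' r'] //.
- move=> _ /= lE; rewrite pweight1; apply: pweight_ge0 => e _; exact: gdist_ge0.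
rewrite /=; have [<- sub lE | _ sub lE] := eqVneq y' y.
  by rewrite !pweight_cons lerD2l IH.
have := IH y (y' :: r') sub lE; rewrite !pweight_cons.
have := gdist_triangle x y y'; lra.
Qed.

Lemma tight_subseq x r' r : subseq r' r -> last x r' = last x r ->
  tight x r -> tight x r'.
Proof. by rewrite /tight => sub lE; rewrite lE; apply/le_trans/subseq_chain. Qed.

(* An edge of a subchain contains an edge of the chain with the same origin. *)
Lemma tight_subseq_edge x r' r e : subseq r' r -> last x r' = last x r ->
  tight x r -> e \in edges (x :: r') -> exists2 v,
    (e.1, v) \in edges (x :: r) & gdist (e.1, v) + gdist (v, e.2) <= gdist e.
Proof.
elim: r x r' => [|y r IH] x [|y' r'] //; rewrite ?edges1 //.
rewrite /=; have [-> sub lE tg | _ sub lE tg] := eqVneq y' y.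
  rewrite edges_cons inE => /predU1P [-> | er].
    by exists y; rewrite ?edges_cons ?mem_head //= gdist_refl addr0.
  have [tg' _] := tight_cons tg; have [v vr vd] := IH y r' sub lE tg' er.
  by exists v => //; rewrite edges_cons in_cons vr orbT.
have [tg' le] := tight_cons tg.
rewrite edges_cons inE => /predU1P [-> | er].
  exists y; first by rewrite edges_cons mem_head.
  have tg2 : tight y (y' :: r') by apply: tight_subseq sub lE tg'.
  have [_] := tight_cons tg2; rewrite /= in lE *; rewrite lE => le2.
  have := gdist_triangle x y' (last y r); lra.
have [|v vr vd] := IH y (y' :: r') sub lE tg'.
  by rewrite edges_cons in_cons er orbT.
by exists v => //; rewrite edges_cons in_cons vr orbT.
Qed.

Lemma covers_shrink s t u v y :
  gdist (u, v) + gdist (v, y) <= gdist (u, y) -> covers s t (u, y) ->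
  covers s t (u, v).
Proof. by rewrite /covers /=; have := gdist_triangle v y t; lra. Qed.

End Geodesics.

(** * Perturbation of the weights to unique geodesics *)

Lemma binary_digits_inj m (f g : nat -> bool) :
  (\sum_(i < m) f i * 2 ^ i = \sum_(i < m) g i * 2 ^ i)%N ->
  forall i, (i < m)%N -> f i = g i.
Proof.
elim: m f g => [//|m IH] f g.
have shift (h : nat -> bool) : (\sum_(i < m.+1) h i * 2 ^ i =
    h 0%N + (\sum_(i < m) h i.+1 * 2 ^ i).*2)%N.
  rewrite big_ord_recl /= expn0 muln1 -mul2n big_distrr /=; congr addn.
  by apply: eq_bigr => i _; rewrite /bump /= add1n expnS; lia.
rewrite !shift => eq01 [_|i im].
  by have /(congr1 odd) := eq01; rewrite !oddD !odd_double !addbF !oddb.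
apply: (IH (fun i => f i.+1) (fun i => g i.+1)) => //.
have /(congr1 half) := eq01.
by rewrite !(@half_bit_double _ (_ : bool)).
Qed.

Section Perturbation.
Variables (R : realType) (n : nat).
Implicit Types (w : 'I_n * 'I_n -> R) (E : {set 'I_n * 'I_n}).
Implicit Types (x y z s t : 'I_n) (q r : seq 'I_n).

Definition binary_weight (e : 'I_n * 'I_n) : R := (2 ^ enum_rank e)%:R.

(** The weight of a simple path is a number whose binary digits list its edges, and the edges
    determine the path. *)
Lemma binary_weight_inj x r r' : uniq (x :: r) -> uniq (x :: r') ->
  last x r = last x r' ->
  pweight binary_weight (x :: r) = pweight binary_weight (x :: r') -> r = r'.
Proof.
move=> u u' lE; rewrite !pweightE -!natr_sum => /eqP; rewrite eqr_nat => /eqP sE.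
apply: (simple_path_sub_eq u u' lE) => e er.
pose dig q k := if insub k is Some i then enum_val (i : 'I_#|{: 'I_n * 'I_n}|) \in edges q
  else false.
have digE q : uniq (edges q) -> (\sum_(e <- edges q) 2 ^ enum_rank e =
    \sum_(i < #|{: 'I_n * 'I_n}|) dig q i * 2 ^ i)%N.
  move=> uq; rewrite big_uniq //= big_mkcond big_enum_val /=.
  apply: eq_bigr => i _; rewrite /dig valK enum_valK /=.
  by case: (_ \in _); rewrite ?mul1n.
have := binary_digits_inj (m := #|{: 'I_n * 'I_n}|)
  (f := dig (x :: r)) (g := dig (x :: r')).
rewrite -(digE _ (edges_uniq u)) -(digE _ (edges_uniq u')).
move=> /(_ sE (enum_rank e) (ltn_ord _)).
by rewrite /dig valK enum_rankK er => <-.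
Qed.

(* Non-edges get weight at least 1, edges a small multiple of their weight, and
   a much smaller multiple of [binary_weight] makes all ties break. *)
Lemma unique_geodesics_exist E w : nonneg_weights E w ->
  exists (W : 'I_n * 'I_n -> R) (geo : 'I_n -> 'I_n -> seq 'I_n),
    unique_geodesics W geo /\
    forall s t q, is_path E s t q -> is_path E s t (s :: geo s t) /\
      pweight w (s :: geo s t) <= pweight w q.
Proof.
move=> w_ge0.
pose w0 e : R := (e \notin E)%:R; pose w1 e : R := if e \in E then w e else 0.
have [d d_gt0 dP] := tie_breaking (pweight w1) (pweight binary_weight).
pose w2 e := w1 e + d * binary_weight e.
have [c c_gt0 cP] := tie_breaking (pweight w0) (pweight w2).
pose W e := w0 e + c * w2 e.
have w2E q : pweight w2 q = pweight w1 q + d * pweight binary_weight q.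
  by rewrite /w2 pweightD pweightZ.
have WE q : pweight W q = pweight w0 q + c * pweight w2 q.
  by rewrite /W pweightD pweightZ.
have W_gt0 e : 0 < W e.
  rewrite /W /w2 ltr_wpDl ?ler0n // mulr_gt0 // ltr_wpDl //.
    by rewrite /w1; case: ifP => // eE; apply: w_ge0.
  by rewrite mulr_gt0 // /binary_weight ltr0n expn_gt0.
have W_inj x r r' : uniq (x :: r) -> uniq (x :: r') -> last x r = last x r' ->
    pweight W (x :: r) = pweight W (x :: r') -> r = r'.
  move=> u u' lE; rewrite !WE.
  have [l|l|->] := ltgtP (pweight w0 (x :: r)) (pweight w0 (x :: r')).
  - by move=> eqW; have := cP _ _ u u' l; rewrite eqW ltxx.
  - by move=> eqW; have := cP _ _ u' u l; rewrite eqW ltxx.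
  move/addrI/(mulfI (lt0r_neq0 c_gt0)); rewrite !w2E.
  have [l|l|->] := ltgtP (pweight w1 (x :: r)) (pweight w1 (x :: r')).
  - by move=> eqW; have := dP _ _ u u' l; rewrite eqW ltxx.
  - by move=> eqW; have := dP _ _ u' u l; rewrite eqW ltxx.
  move/addrI/(mulfI (lt0r_neq0 d_gt0)); exact: binary_weight_inj.
have /choice [g gP] (xz : 'I_n * 'I_n) : exists r, [/\ uniq (xz.1 :: r),
    last xz.1 r = xz.2 & forall r', uniq (xz.1 :: r') -> last xz.1 r' = xz.2 ->
      pweight W (xz.1 :: r) <= pweight W (xz.1 :: r')].
  (* Geodesics are taken in the complete digraph, where a path always exists. *)
  case: xz => x z /=; pose Q q := is_path [set: 'I_n * 'I_n] x z q.
  have Qu q : Q q -> uniq q by move=> /is_pathP [r [->]].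
  have [q0 Qq0] : exists q0, Q q0.
    have [xz|xz] := eqVneq x z; first by exists [:: x]; rewrite /Q /= xz !eqxx.
    by exists [:: x; z]; rewrite /Q /= !eqxx !inE /= xz.
  have [q /is_pathP [r [-> u l _]] qmin] := simple_argmin (pweight W) Qu Qq0.
  exists r; split=> // r' u' l'; apply: qmin.
  by apply/is_pathP; exists r'; split=> // e; rewrite inE.
exists W, (fun x z => g (x, z)).
have gu : forall x z, uniq (x :: g (x, z)) by move=> x z; case: (gP (x, z)).
have gl : forall x z, last x (g (x, z)) = z by move=> x z; case: (gP (x, z)).
have gm : forall x r, uniq (x :: r) ->
    pweight W (x :: g (x, last x r)) <= pweight W (x :: r).
  by move=> x r u; case: (gP (x, last x r)) => _ _; apply.
split.
  split=> // x r u rN; rewrite lt_neqAle gm // andbT.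
  by apply: contraNneq rN => /W_inj ->.
move=> s t _ /is_pathP [r [-> u l sub]]; set p := g (s, t).
have up : uniq (s :: p) by exact: gu.
have := gm s r u; rewrite l -/p => le.
have w0r : pweight w0 (s :: r) = 0.
  rewrite pweightE big_seq big1 // => e /sub eE; by rewrite /w0 eE.
(* If the geodesic used a non-edge, [cP] would make it heavier than the path [r], which stays inside
   [E]. *)
have w0p : pweight w0 (s :: p) <= 0.
  rewrite leNgt -w0r; apply/negP => /(cP _ _ u up); rewrite -!WE.
  by rewrite ltNge le.
have subp : {subset edges (s :: p) <= E}.
  move=> e ep; apply: contraTT w0p => eE; rewrite -ltNge pweightE.
  rewrite (perm_big _ (perm_to_rem ep)) big_cons /w0 eE ltr_pwDl ?ltr01 //.
  by apply: sumr_ge0.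
have w1E q : {subset edges q <= E} -> pweight w1 q = pweight w q.
  by move=> sq; apply: eq_pweight => e /sq eE; rewrite /w1 eE.
split; first by apply/is_pathP; exists p; split=> //; exact: gl.
rewrite -!w1E // leNgt; apply/negP => /(dP _ _ u up); rewrite -!w2E.
have w0p0 : pweight w0 (s :: p) = 0.
  by rewrite pweightE big_seq big1 // => e /subp eE; rewrite /w0 eE.
by move: le; rewrite !WE w0r w0p0 !add0r ler_pM2l // leNgt => /negP.
Qed.

End Perturbation.

(** * Chain systems and the graphs realizing them *)

Section ChainSystems.
Variables (R : realType) (n : nat).
Variables (W : 'I_n * 'I_n -> R) (geo : 'I_n -> 'I_n -> seq 'I_n).
Hypothesis geoP : unique_geodesics W geo.
Implicit Types (c : 'I_n * seq 'I_n) (L : seq ('I_n * seq 'I_n)).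
Implicit Types (e : 'I_n * 'I_n) (r : seq 'I_n).

Let gdist := gdist W geo.
Let covers := covers W geo.
Let tight := tight W geo.

Definition chain_edges L := flatten [seq edges (c.1 :: c.2) | c <- L].

Definition chain_ends c : 'I_n * 'I_n := (c.1, last c.1 c.2).

(* Chains are listed latest first: no edge of a chain may be covered by a chain
   further down the list. *)
Fixpoint chain_system L : Prop :=
  if L is c :: L' then
    [/\ c.2 != [::], uniq (c.1 :: c.2), tight c.1 c.2,
        forall e st, e \in edges (c.1 :: c.2) -> st \in map chain_ends L' ->
          ~~ covers st.1 st.2 e &
        chain_system L']
  else True.

(** A simple path has fewer than [n] edges, so with base [n.+1] one edge of a chain outweighs all
    edges that a simple path takes from chains further down the list. *)
Fixpoint discount L e : nat :=
  if L is c :: L' then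
    if e \in edges (c.1 :: c.2) then (n.+1 ^ size L')%N else discount L' e
  else 0%N.

Lemma discount_le L e : (discount L e * n.+1 <= n.+1 ^ size L)%N.
Proof.
elim: L => [|c L IH] /=; first by rewrite mul0n.
case: ifP => _; first by rewrite expnSr.
by apply: (leq_trans IH); rewrite leq_pexp2l.
Qed.

Lemma chain_systemP L c : chain_system L -> c \in L ->
  [/\ c.2 != [::], uniq (c.1 :: c.2) & tight c.1 c.2].
Proof.
elim: L => //= c0 L IH [c0N c0u c0t _ /IH cL].
by rewrite inE => /predU1P [-> | /cL].
Qed.

(* Later chains have a much larger discount per edge, and a tight path between
   the ends of a chain cannot use edges of later chains. *)
Lemma discount_lt L c r : chain_system L -> c \in L ->
  uniq (c.1 :: r) -> last c.1 r = last c.1 c.2 -> tight c.1 r -> r != c.2 ->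
  (\sum_(e <- edges (c.1 :: r)) discount L e <
   \sum_(e <- edges (c.1 :: c.2)) discount L e)%N.
Proof.
move=> sysL cL ur lr tr rN; elim: L sysL cL => // c0 L IH.
move=> [c0N c0u c0t c0c sysL]; rewrite inE => /predU1P [cE | cL]; last first.
  have [cN cu ct] := chain_systemP sysL cL.
  have skip r' : tight c.1 r' -> last c.1 r' = last c.1 c.2 ->
      (\sum_(e <- edges (c.1 :: r')) discount (c0 :: L) e =
       \sum_(e <- edges (c.1 :: r')) discount L e)%N.
    move=> t' l'; apply: eq_big_seq => e e' /=; case: ifP => //.
    move=> /c0c /(_ (map_f chain_ends cL)).
    by rewrite /= -l' /covers tight_covers.
  by rewrite !skip //; apply: IH.
rewrite -{}cE in c0N c0u c0t c0c *.
set K := (n.+1 ^ size L)%N; set A := edges (c.1 :: c.2).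
have K_gt0 : (0 < K)%N by rewrite expn_gt0.
have -> : (\sum_(e <- A) discount (c :: L) e = size A * K)%N.
  rewrite (eq_big_seq (fun=> K)) => [|e eA]; last by rewrite /= eA.
  by rewrite big_const_seq count_predT iter_addn_0 mulnC.
set s := edges (c.1 :: r); have us : uniq s by exact: edges_uniq.
rewrite (bigID (mem A)) /= (eq_bigr (fun=> K)) => [|e ->//].
rewrite big_const_seq iter_addn_0 mulnC.
have cnt : (count (mem A) s < size A)%N.
  apply: count_lt_size us _; apply: contra rN => /allP sub.
  by apply/eqP/esym/(simple_path_sub_eq c0u ur (esym lr)).
(* The path [r] misses an edge of [c] and so loses at least [K], more than all its edges outside [c]
   bring in. *)
suff rest : (\sum_(e <- s | e \notin A) discount (c :: L) e < K)%N.
  apply: (@leq_trans (count (mem A) s * K + K)%N); first by rewrite ltn_add2l.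
  by rewrite -mulSnr leq_mul2r cnt orbT.
rewrite -(ltn_pmul2r (ltn0Sn n)).
apply: (@leq_ltn_trans (n * K)%N); last by rewrite mulnC ltn_pmul2l.
rewrite big_distrl /=.
apply: (@leq_trans (\sum_(e <- s | e \notin A) K)%N).
  apply: leq_sum => e eA /=; rewrite (negPf eA); exact: discount_le.
rewrite big_const_seq iter_addn_0 mulnC leq_mul2r; apply/orP; right.
apply: (leq_trans (count_size _ _)); rewrite size_edges.
by apply: ltnW; apply: (uniq_size_le ur).
Qed.

Lemma mem_chain_edges L c e :
  c \in L -> e \in edges (c.1 :: c.2) -> e \in chain_edges L.
Proof. by move=> cL ec; apply/flatten_mapP; exists c. Qed.

(** The weight is [gdist] minus a tiny multiple of the discount. A path between the ends of a chain
    that is not tight is already longer for [gdist]; tight ones tie there, and the discount favours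
    the chain. *)
Theorem chain_system_realizable L : chain_system L ->
  exists (E : {set 'I_n * 'I_n}) (w : 'I_n * 'I_n -> R), nonneg_weights E w /\
  forall c, c \in L -> unique_shortest E w c.1 (last c.1 c.2) (c.1 :: c.2).
Proof.
move=> sysL; pose D e : R := - (discount L e)%:R.
have [eps eps_gt0 epsP] := tie_breaking (pweight gdist) (pweight D).
pose w e := gdist e + eps * D e.
have wE q : pweight w q = pweight gdist q + eps * pweight D q.
  by rewrite /w pweightD pweightZ.
exists [set e in chain_edges L], w; split.
  move=> e; rewrite inE => /flatten_mapP [c cL ec].
  have [_ cu _] := chain_systemP sysL cL; have e12 := edges_neq cu ec.
  (* The one-node path has weight 0 and is strictly shorter for [gdist], so tie breaking keeps the
     weight of [e] positive. *)
  have := epsP [:: e.1] [:: e.1; e.2]; rewrite -!wE /= inE e12 => /(_ isT isT).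
  rewrite !pweight_cons !pweight1 !addr0; case: e e12 {ec} => u v /= uv.
  by move=> lt; apply/ltW/lt/gdist_gt0.
move=> c cL; have [cN cu ct] := chain_systemP sysL cL; split.
  apply/is_pathP; exists c.2; split=> // e ec; rewrite inE.
  exact: mem_chain_edges ec.
move=> _ /is_pathP [r [-> ur lr _]]; rewrite eqseq_cons eqxx /= => rN.
have [tr|] := boolP (tight c.1 r); last first.
  rewrite -ltNge lr => lt; rewrite !wE; apply: epsP => //.
  exact: le_lt_trans ct lt.
have -> : pweight w (c.1 :: c.2) = gdist (chain_ends c) + eps * pweight D (c.1 :: c.2).
  rewrite wE; congr (_ + _); apply/eqP; rewrite eq_le.
  by apply/andP; split; [exact: ct | exact: gdist_chain].
have -> : pweight w (c.1 :: r) = gdist (chain_ends c) + eps * pweight D (c.1 :: r).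
  rewrite wE; congr (_ + _); apply/eqP; rewrite /chain_ends -lr eq_le.
  by apply/andP; split; [exact: tr | exact: gdist_chain].
rewrite ltrD2l ltr_pM2l // !pweightE !sumrN ltrN2 -!natr_sum ltr_nat.
exact: discount_lt.
Qed.

(** The ends of a tight chain cover each of its edges, so no chain nearer the head of the list can
    reuse one. *)
Lemma chain_edges_uniq L : chain_system L -> uniq (chain_edges L).
Proof.
elim: L => //= c L IH [cN cu ct cc sysL].
rewrite /chain_edges /= cat_uniq edges_uniq //= IH // andbT.
apply/hasPn => e /flatten_mapP [c' c'L ec']; apply/negP => /cc /(_ (map_f chain_ends c'L)).
have [_ _ t'] := chain_systemP sysL c'L.
by rewrite /covers tight_covers.
Qed.

Lemma size_chain_edges L :
  size (chain_edges L) = (\sum_(c <- L) size c.2)%N.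
Proof.
elim: L => [|c L IH]; first by rewrite big_nil.
by rewrite /chain_edges /= size_cat big_cons -IH size_edges.
Qed.

End ChainSystems.

(** * Lower bounds for preservers and oracles *)

Lemma bitseq_count (T : eqType) (S : seq T) (h : T -> bitseq) b m :
  uniq S -> {in S &, injective h} -> {in S, forall x, size (h x) <= b}%N ->
  size S = (2 ^ m)%N -> (m <= 2 * b)%N.
Proof.
move=> uS hI hb sS.
(* Positions past the end read [None], so the strings inject into [3 ^ b] functions; the factor 2
   comes from [3 ^ b <= 4 ^ b]. *)
pose g x : {ffun 'I_b -> option bool} := [ffun i : 'I_b => onth (h x) i].
have gI : {in S &, injective g}.
  move=> x y xS yS /ffunP gE; apply: hI => //; apply/eq_from_onth => i.
  have [ib|bi] := ltnP i b; first by have := gE (Ordinal ib); rewrite !ffunE.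
  by rewrite !onth_default ?(leq_trans _ bi) ?hb.
have : (size (map g S) <= #|{: {ffun 'I_b -> option bool}}|)%N.
  by rewrite -(card_uniqP _) ?max_card // map_inj_in_uniq.
rewrite size_map sS card_ffun card_option card_bool card_ord => le.
have : (2 ^ m <= 2 ^ (2 * b))%N.
  apply: (leq_trans le); rewrite expnM.
  by have [->|b_gt0] := posnP b; rewrite ?expn0 // leq_exp2r.
by rewrite leq_exp2l.
Qed.

Section LowerBounds.
Variables (R : realType) (n : nat).
Implicit Types (s t x y : 'I_n) (r : seq 'I_n) (P E : {set 'I_n * 'I_n}).
Implicit Types (c : 'I_n * seq 'I_n) (L M : seq ('I_n * seq 'I_n)).

Lemma unit_edge_unique_shortest E s t : s != t -> (s, t) \in E ->
  unique_shortest E (fun=> 1 : R) s t [:: s; t].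
Proof.
move=> st stE; split; first by rewrite /= !eqxx !inE stE st.
have sizeE x r : pweight (fun=> 1 : R) (x :: r) = (size r)%:R.
  by rewrite pweightE big_const_seq count_predT iter_addr_0 size_edges.
move=> _ /is_pathP [r [-> ur lr _]] rN; rewrite !sizeE ltr_nat /=.
case: r lr rN {ur} => [|y [|z r]] //= lr; first by rewrite lr eqxx in st.
by rewrite lr eqxx.
Qed.

(** For [n] at least 2 at least half of all pairs are off the diagonal; [P] takes these first. *)
Lemma mostly_offdiagonal p : (1 < n)%N -> (p <= n * n)%N ->
  exists P, #|P| = p /\ (p <= 2 * #|[set e in P | e.1 != e.2]|)%N.
Proof.
move=> n_gt1 pn; pose A := [set e : 'I_n * 'I_n | e.1 != e.2].
have cA : (#|A| + n = n * n)%N.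
  have cC : #|~: A| = n.
    rewrite -[RHS]card_ord -(card_imset _ (f := fun x : 'I_n => (x, x))); last first.
      by move=> x y [].
    apply: eq_card => -[x y]; rewrite !inE negbK /=.
    by apply/eqP/imsetP => [->|[z _ [-> ->]]] //; exists y.
  by have := cardsC A; rewrite cC card_prod card_ord.
have le_takes : (p <= size (enum A ++ enum (~: A)))%N.
  by rewrite size_cat -!cardE cardsC card_prod card_ord.
have u : uniq (enum A ++ enum (~: A)).
  rewrite cat_uniq !enum_uniq /= andbT; apply/hasPn => e.
  by rewrite /= !mem_enum inE.
pose P := [set e in take p (enum A ++ enum (~: A))].
exists P; split.
  by rewrite cardsE (card_uniqP (take_uniq _ u)) size_takel.
have sub : [set e in take p (enum A)] \subset [set e in P | e.1 != e.2].
  apply/fintype.subsetP => e; rewrite !inE => eA.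
  have -> : e.1 != e.2.
    by have := mem_take eA; rewrite mem_enum inE.
  rewrite andbT take_cat; case: ifP => // /negbT; rewrite -leqNgt => Ap.
  by rewrite mem_cat; move: eA; rewrite take_oversize // => ->.
have := subset_leq_card sub.
rewrite cardsE (card_uniqP (take_uniq _ (enum_uniq _))) size_take -cardE.
have nn : (n * 2 <= n * n)%N by rewrite leq_mul2l n_gt1 orbT.
move: #|[set e in P | e.1 != e.2]| #|A| cA => a b; clear -pn nn.
by case: ifP; lia.
Qed.

(** In the unit weighted graph whose edges are the off-diagonal demand pairs, every edge is a unique
    shortest path and must be kept. *)
Lemma DP_ok_ge_pairs p k : (1 < n)%N -> (p <= n * n)%N -> DP_ok R n p k ->
  (p <= 2 * k)%N.
Proof.
move=> n_gt1 pn DPk; have [P [Pp le]] := mostly_offdiagonal n_gt1 pn.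
set B := [set e in P | _] in le.
have w_ge0 : nonneg_weights B (fun=> 1 : R) by move=> *; apply: ler01.
have [EH [EHP EHk]] := DPk B _ w_ge0 P Pp.
apply: (leq_trans le); rewrite leq_mul2l /=; apply: leq_trans EHk.
apply/subset_leq_card/fintype.subsetP => -[s t] eB.
have := eB; rewrite inE => /andP [eP st].
have := unique_shortest_preserved EHP eP (unit_edge_unique_shortest st eB).
by case/is_pathP => r [[<-] _ _]; apply; rewrite edges_cons mem_head.
Qed.

(** Every subset of the off-diagonal demand pairs is the edge set of a unit weighted graph, and the
    answers reveal it: a pair is an edge exactly when it is answered by the path of its two
    nodes. *)
Lemma SPO_ok_ge_pairs p b : (1 < n)%N -> (p <= n * n)%N -> SPO_ok R n p b ->
  (p <= 4 * b)%N.
Proof.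
move=> n_gt1 pn [D DP]; have [P [Pp le]] := mostly_offdiagonal n_gt1 pn.
set B := [set e in P | _] in le.
have w_ge0 E : nonneg_weights E (fun=> 1 : R) by move=> *; apply: ler01.
have /choice [h hP] E := DP E _ (w_ge0 E) P Pp.
suff : (#|B| <= 2 * b)%N by lia.
apply: (@bitseq_count _ (enum (powerset B)) h).
- exact: enum_uniq.
- pose rec bs := [set e in B | D bs e.1 e.2 == Some [:: e.1; e.2]].
  apply: (can_in_inj (g := rec)) => E; rewrite mem_enum powersetE => /fintype.subsetP EB.
  have [_ ansE] := hP E; apply/setP => -[s t]; rewrite inE /=.
  have [eE|eN] := boolP ((s, t) \in E).
    have eB := EB _ eE; have := eB; rewrite inE => /andP [eP st].
    have := unique_shortest_answer (unit_edge_unique_shortest st eE) (ansE _ _ eP).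
    by move=> ->; rewrite eqxx eP st.
  apply/negbTE/negP => /andP [eB /eqP ans]; move: eB; rewrite inE => /andP [eP _].
  have := ansE _ _ eP; rewrite ans /= => -[/and4P [_ /andP [] ]].
  by rewrite (negPf eN).
- by move=> E _; case: (hP E).
by rewrite -cardE card_powerset.
Qed.

Variables (W : 'I_n * 'I_n -> R) (geo : 'I_n -> 'I_n -> seq 'I_n).
Hypothesis geoP : unique_geodesics W geo.

(** In the realizing graph a preserver contains every chain, and distinct chains share no edge. *)
Lemma DP_ok_ge_chains L P k : chain_system W geo L ->
  {subset map (@chain_ends n) L <= P} -> DP_ok R n #|P| k ->
  (\sum_(c <- L) size c.2 <= k)%N.
Proof.
move=> sysL LP DPk; have [E [w [w_ge0 wL]]] := chain_system_realizable geoP sysL.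
have [EH [EHP EHk]] := DPk E w w_ge0 P erefl.
apply: leq_trans EHk; rewrite -size_chain_edges.
rewrite -(card_uniqP (chain_edges_uniq geoP sysL)).
apply/subset_leq_card/fintype.subsetP => e /flatten_mapP [c cL ec].
have := unique_shortest_preserved EHP (LP _ (map_f _ cL)) (wL c cL).
by case/is_pathP => r [[<-] _ _]; apply.
Qed.

(* All subsequences of [r] that keep its last element. *)
Fixpoint subchains r : seq (seq 'I_n) :=
  if r is y :: r' then
    if r' is [::] then [:: [:: y]]
    else map (cons y) (subchains r') ++ subchains r'
  else [:: [::]].

Lemma size_subchains r : size (subchains r) = (2 ^ (size r).-1)%N.
Proof.
elim: r => [|y [|z r] IH] //.
rewrite [subchains _]/(map (cons y) (subchains (z :: r)) ++ subchains (z :: r)).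
by rewrite size_cat size_map IH /= expnS mul2n addnn.
Qed.

Lemma subchainsP r r' : r' \in subchains r ->
  [/\ subseq r' r, forall x, last x r' = last x r & (r != [::] -> r' != [::])].
Proof.
elim: r r' => [|y [|z r] IH] r'; try by rewrite inE => /eqP ->; split=> //=; rewrite eqxx.
rewrite [subchains _]/(map (cons y) (subchains (z :: r)) ++ subchains (z :: r)).
rewrite mem_cat => /orP [/mapP [r1 /IH [sub l1 _] ->]|/IH [sub l1 N]].
  by split=> //= *; rewrite ?eqxx // l1.
have rN := N isT; split=> //; exact: subseq_trans (subseq_cons _ _).
Qed.

Lemma subchains_uniq r : uniq r -> uniq (subchains r).
Proof.
elim: r => [|y [|z r] IH] //= /andP [yr ur].
rewrite -/(subchains (z :: r)) cat_uniq map_inj_uniq ?IH //; last by move=> ? ? [].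
rewrite andbT; apply/hasPn => r' /subchainsP [sub _ _].
apply/negP => /mapP [r1 _ r'E]; move: yr; rewrite (mem_subseq sub) //.
by rewrite r'E mem_head.
Qed.

Fixpoint subsystems L : seq (seq ('I_n * seq 'I_n)) :=
  if L is c :: L' then
    [seq (c.1, r) :: M | r <- subchains c.2, M <- subsystems L']
  else [:: [::]].

Lemma size_subsystems L :
  size (subsystems L) = (2 ^ \sum_(c <- L) (size c.2).-1)%N.
Proof.
elim: L => [|c L IH]; first by rewrite big_nil.
by rewrite /= size_allpairs IH size_subchains big_cons expnD.
Qed.

Lemma subsystems_uniq L : chain_system W geo L -> uniq (subsystems L).
Proof.
elim: L => // c L IH [_ /andP [_ cu] _ _ sysL]; apply: allpairs_uniq.
- exact: subchains_uniq.
- exact: IH.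
by move=> [r1 M1] [r2 M2] _ _ /= [-> ->].
Qed.

(** The ends do not change, and a covered edge of a subchain would make an edge of the original
    chain covered. *)
Lemma subsystemsP L M : chain_system W geo L -> M \in subsystems L ->
  chain_system W geo M /\ map (@chain_ends n) M = map (@chain_ends n) L.
Proof.
elim: L M => [|c L IH] M; first by rewrite inE => _ /eqP ->.
move=> [cN cu ct cc sysL] /allpairsP [[r M'] /= [rc /(IH _ sysL) [sysM endM] ->]].
have [sub lr rN] := subchainsP rc; split; last first.
  by rewrite /= endM /chain_ends /= lr.
split=> //=.
- exact: rN.
- have /subseq_uniq/(_ cu) // : subseq (c.1 :: r) (c.1 :: c.2).
  by rewrite /= eqxx.
- exact: (tight_subseq geoP sub (lr _) ct).
move=> e st er; rewrite endM => stL.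
have [v vc vd] := tight_subseq_edge geoP sub (lr _) ct er.
apply: contra (cc _ _ vc stL); case: e vd {er vc} => u y.
exact: (covers_shrink geoP).
Qed.

(** All subsystems have the same ends, so the same queries recover each of them from its bit string;
    each interior node contributes a free binary choice. *)
Lemma SPO_ok_ge_chains L P b : chain_system W geo L ->
  {subset map (@chain_ends n) L <= P} -> SPO_ok R n #|P| b ->
  (\sum_(c <- L) (size c.2).-1 <= 2 * b)%N.
Proof.
move=> sysL LP [D DP].
have /choice [h hP] M : exists bs, M \in subsystems L -> (size bs <= b)%N /\
    forall c, c \in M -> D bs c.1 (last c.1 c.2) = Some (c.1 :: c.2).
  have [ML|] := boolP (M \in subsystems L); last by exists [::].
  have [sysM endM] := subsystemsP sysL ML.
  have [E [w [w_ge0 wM]]] := chain_system_realizable geoP sysM.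
  have [bs [bsb ans]] := DP E w w_ge0 P erefl; exists bs => _; split=> // c cM.
  apply: unique_shortest_answer (wM c cM) (ans _ _ _); apply: LP; rewrite -endM.
  by apply: map_f cM.
apply: (@bitseq_count _ (subsystems L) h).
- exact: subsystems_uniq.
- pose rec bs := [seq (st.1, behead (odflt [::] (D bs st.1 st.2)))
    | st <- map (@chain_ends n) L].
  apply: (can_in_inj (g := rec)) => M ML; have [_ ans] := hP M ML.
  have [_ endM] := subsystemsP sysL ML; rewrite /rec -endM -map_comp -[RHS]map_id.
  by apply/eq_in_map => c cM /=; rewrite ans //=; case: c cM.
- by move=> M /hP [].
exact: size_subsystems.
Qed.

End LowerBounds.

Section Sparsification.
Variables (T : eqType) (C : pred (T * T)).
Implicit Types (x y u v : T) (r q : seq T).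

Fixpoint sparse q : bool :=
  if q is a :: ((_ :: c :: _) as q') then ~~ C (a, c) && sparse q' else true.

(** Greedily drops the node after [x] as long as [C] relates [x] to the node after that one; the new
    first edge is then good because it satisfies [C]. *)
Lemma sparsify_head (good : pred (T * T)) x v r :
  good (x, v) -> (forall e, C e -> good e) -> all good (edges (v :: r)) ->
  sparse (v :: r) ->
  exists r', [/\ subseq r' (v :: r), last x r' = last v r,
    all good (edges (x :: r')) & sparse (x :: r')].
Proof.
move=> xv Cg; elim: r v xv => [|u r IH] v xv.
  by exists [:: v]; split; rewrite //= ?eqxx // edges_cons edges1 /= xv.
rewrite edges_cons /= => /andP [vu ur] sp; have [xu|xu] := boolP (C (x, u)).
  have spu : sparse (u :: r) by case: r sp {IH ur} => //= w r /andP [].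
  have [r' [sub lr gr sr]] := IH u (Cg _ xu) ur spu.
  by exists r'; split=> //; apply: subseq_trans sub (subseq_cons _ _).
exists [:: v, u & r]; split=> //; first by rewrite /= !eqxx.
  by rewrite !edges_cons /= xv vu.
by apply/andP.
Qed.

Lemma sparsify x r : exists r', [/\ subseq r' r, last x r' = last x r,
  all (fun e => C e || (e \in edges (x :: r))) (edges (x :: r')) &
  sparse (x :: r')].
Proof.
elim: r x => [|y r IH] x; first by exists [::]; rewrite edges1.
have [r1 [sub1 lr1 /allP g1 s1]] := IH y.
pose good e := C e || (e \in edges [:: x, y & r]).
have [|e eC||r' [sub lr gr sr]] := @sparsify_head good x y r1 _ _ _ s1.
- by rewrite /good edges_cons mem_head orbT.
- by rewrite /good eC.
- apply/allP => e /g1 /orP [eC|er]; rewrite /good ?eC // edges_cons in_cons er.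
  by rewrite !orbT.
exists r'; split=> //; last by rewrite lr lr1.
by apply: subseq_trans sub _; rewrite /= eqxx.
Qed.

End Sparsification.

(** * Coding geodesics by chains *)

Section Codes.
Variables (R : realType) (n : nat).
Variables (W : 'I_n * 'I_n -> R) (geo : 'I_n -> 'I_n -> seq 'I_n).
Hypothesis geoP : unique_geodesics W geo.
Implicit Types (s t u v x y : 'I_n) (r q : seq 'I_n) (e : 'I_n * 'I_n).
Implicit Types (c : 'I_n * seq 'I_n) (V L : seq ('I_n * seq 'I_n)).
Implicit Types (ps : seq ('I_n * 'I_n)).

Let covers := covers W geo.
Let tight := tight W geo.
Let geodesic e := e.1 :: geo e.1 e.2.

Definition covered ps e : bool := has (fun st => covers st.1 st.2 e) ps.

Lemma covered_shrink ps u v y :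
  gdist W geo (u, v) + gdist W geo (v, y) <= gdist W geo (u, y) ->
  covered ps (u, y) -> covered ps (u, v).
Proof.
by move=> le /hasP [st stps /(covers_shrink geoP le) c]; apply/hasP; exists st.
Qed.

(** Every second node is kept. A step over two edges is uncovered by sparsity; for odd length the
    last step spans three edges and is uncovered because it contains such a step with the same
    origin. *)
Lemma halve_sparse ps x r : tight x r -> sparse (covered ps) (x :: r) ->
  (1 < size r)%N -> exists r', [/\ subseq r' r, last x r' = last x r, r' != [::],
    (size r <= (2 * size r').+1)%N &
    {in edges (x :: r'), forall e, ~~ covered ps e}].
Proof.
have [m] := ubnP (size r); elim: m x r => // m IH x.
case=> [|a [|b [|c [|d r]]]] // rm tr sp _; rewrite /= in sp.
- rewrite andbT in sp; exists [:: b]; split=> //; first exact: subseq_cons.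
  by move=> e; rewrite edges_cons edges1 inE => /eqP ->.
- case/and3P: sp => xb _ _; exists [:: c]; split=> //; first exact: (suffix_subseq [:: a; b]).
  move=> e; rewrite edges_cons edges1 inE => /eqP ->.
  apply: contra xb; apply: covered_shrink.
  have tr' : tight x [:: b; c].
    by apply: (tight_subseq geoP _ _ tr) => //; apply: subseq_cons.
  by have [_] := tight_cons geoP tr'.
case/and3P: sp => xb _ sp.
have tr' : tight x [:: b, c, d & r].
  by apply: (tight_subseq geoP _ _ tr) => //; apply: subseq_cons.
have [tb _] := tight_cons geoP tr'.
have [|r' [sub lr rN sr cr]] := IH b [:: c, d & r] _ tb sp isT.
  by move: rm => /=; lia.
exists (b :: r'); split=> //.
- by apply: (@subseq_trans _ [:: b, c, d & r]); rewrite ?subseq_cons //= eqxx.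
- by move: sr => /=; lia.
move=> e; rewrite edges_cons inE => /predU1P [-> // | er]; exact: cr.
Qed.

(* [V] lists, for every pair of [ps], a chain on its geodesic whose edges are
   edges of the geodesic or are covered by pairs further down the list. *)
Fixpoint coding ps V : Prop :=
  match ps, V with
  | [::], [::] => True
  | st :: ps', c :: V' =>
    [/\ chain_ends c = st, tight c.1 c.2,
        {in edges (c.1 :: c.2), forall e,
          covered ps' e || (e \in edges (geodesic st))} &
        coding ps' V']
  | _, _ => False
  end.

(** Sparsifying a geodesic gives its chain in [V], and halving that chain gives the one in [L]. *)
Lemma coding_exists ps : exists V L, [/\ coding ps V, chain_system W geo L,
  {subset map (@chain_ends n) L <= ps}, (size L <= size ps)%N &
  (\sum_(c <- V) size c.2 <= 2 * (\sum_(c <- L) size c.2) + size ps)%N].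
Proof.
elim: ps => [|[s t] ps [V [L [VP LP Lps sL sV]]]].
  by exists [::], [::]; rewrite !big_nil.
case: geoP => _ gu gl _.
have [r [sub lr /allP gr sp]] := sparsify (covered ps) s (geo s t).
have tr : tight s r by apply: (tight_subseq geoP sub lr); exact: (tight_geo geoP).
exists ((s, r) :: V).
have VP' : coding ((s, t) :: ps) ((s, r) :: V).
  by split=> //; rewrite /chain_ends /= lr gl.
have Lps' : {subset map (@chain_ends n) L <= (s, t) :: ps}.
  by move=> e /Lps; rewrite inE orbC => ->.
(* A chain with at most one edge is left out of [L] and charged to [size ps]. *)
have [r2|r1] := ltnP 1 (size r); last first.
  exists L; split=> //=; first exact: leqW.
  by rewrite big_cons; apply: leq_trans (leq_add r1 sV) _; rewrite addnCA add1n.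
have [r' [sub' lr' rN sr cr]] := halve_sparse tr sp r2.
exists ((s, r') :: L); split=> //=; last by
  rewrite !big_cons; apply: leq_trans (leq_add sr sV) _;
  rewrite mulnDr addSn addnS addnA.
- split=> //=.
  + have /subseq_uniq/(_ (gu s t)) // : subseq (s :: r') (s :: geo s t).
    by rewrite /= eqxx; apply: subseq_trans sub' sub.
  + exact: (tight_subseq geoP sub' lr' tr).
  move=> e st er /Lps stps; apply: contra (cr e er) => c.
  by apply/hasP; exists st.
move=> e; rewrite inE => /predU1P [-> | /Lps' //].
by rewrite /chain_ends /= lr' lr gl mem_head.
Qed.

Fixpoint expand (f : 'I_n * 'I_n -> seq 'I_n) x r : seq 'I_n :=
  if r is y :: r' then f (x, y) ++ expand f y r' else [::].

Lemma expand_geo f x r : {in edges (x :: r), forall e, f e = geo e.1 e.2} ->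
  tight x r -> expand f x r = geo x (last x r).
Proof.
elim: r x => [|y r IH] x fE; first by rewrite /= (geo_refl geoP).
move=> /(tight_cons geoP) [tr le] /=; rewrite (geo_cat geoP le) fE ?IH //.
  by move=> e er; rewrite fE // edges_cons in_cons er orbT.
by rewrite edges_cons mem_head.
Qed.

Lemma edge_geo s t e : e \in edges (s :: geo s t) -> geo e.1 e.2 = [:: e.2].
Proof.
case: e => u v /edges_split [/= r1 [r2 [gE lr]]].
have /(infix_geo geoP) [/= <- //] : infix [:: u; v] (s :: geo s t).
rewrite gE -cat_cons (lastI s) lr cat_rcons.
exact: (@infix_infix _ _ [:: u; v] r2).
Qed.

(** A covered chain edge expands to a segment of a geodesic further down the list, whose edges occur
    by induction; so the union of the geodesics is no larger than the code. *)
Lemma coding_edges ps V : coding ps V ->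
  {in ps, forall st, {subset edges (geodesic st) <= chain_edges V}}.
Proof.
elim: ps V => // st ps IH [|c V] //= [<- tr cr /IH sub] st'.
rewrite inE => /predU1P [-> | /sub sub' e /sub']; last first.
  by rewrite /chain_edges /= mem_cat orbC => ->.
have hop : {in edges (c.1 :: c.2), forall e,
    {subset edges (geodesic e) <= chain_edges (c :: V)}}.
  move=> e er f; have := cr e er; rewrite /chain_edges /= mem_cat.
  case/orP => [/hasP [st2 /sub sub' ce] fe|/edge_geo eE].
    by apply/orP; right; apply/sub'/(infix_edges (covers_infix geoP ce)).
  rewrite /geodesic eE edges_cons edges1 inE => /eqP ->.
  by case: e er {eE} => u v ->.
rewrite /geodesic /=; move: c.1 c.2 tr hop {cr} => x r.
elim: r x => [|y r IHr] x; first by rewrite /= (geo_refl geoP) edges1.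
move=> /(tight_cons geoP) [tr le] hop e /=; rewrite (geo_cat geoP le) edges_cat.
rewrite mem_cat; case/orP => [exy|].
  by apply: (hop (x, y)) exy; rewrite edges_cons mem_head.
case: geoP => _ _ -> _; apply: IHr => // f fr.
by apply: hop; rewrite edges_cons in_cons fr orbT.
Qed.

End Codes.

(** * Recovering the geodesics without the weights *)

Section Decoding.
Variable n : nat.
Implicit Types (s t u v x y : 'I_n) (r q : seq 'I_n) (e : 'I_n * 'I_n).
Implicit Types (c : 'I_n * seq 'I_n) (V : seq ('I_n * seq 'I_n)).

(* The segment from [e.1] to [e.2] of some path of [acc], and the edge [e]
   itself if there is none. *)
Definition hop (acc : seq (seq 'I_n)) e : seq 'I_n :=
  xget [:: e.2] [set r | last e.1 r = e.2 /\
    exists2 q, q \in acc & infix (e.1 :: r) q]%classic.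

Definition decode V : seq (seq 'I_n) :=
  foldr (fun c acc => (c.1 :: expand (hop acc) c.1 c.2) :: acc) [::] V.

(** Unreachable pairs will not be coded, so a failed search correctly reports that there is no
    path. *)
Definition answer V s t : option (seq 'I_n) :=
  ohead [seq q <- decode V | (ohead q == Some s) && (last s q == t)].

Variables (R : realType) (W : 'I_n * 'I_n -> R).
Variable geo : 'I_n -> 'I_n -> seq 'I_n.
Hypothesis geoP : unique_geodesics W geo.

(** Any segment of a geodesic is the geodesic between its ends, so the arbitrary choice in [xget] is
    harmless. If no segment is found, [e] is not covered and is an edge of the current geodesic. *)
Lemma hop_geo ps st e : covered W geo ps e || (e \in edges (st.1 :: geo st.1 st.2)) ->
  hop [seq e.1 :: geo e.1 e.2 | e <- ps] e = geo e.1 e.2.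
Proof.
move=> good; rewrite /hop; case: geoP => _ _ gl _.
case: xgetP => [r _ [lr [_ /mapP [st' _ ->] /(infix_geo geoP) [-> _]]]|none].
  by rewrite lr.
suff nc : ~~ covered W geo ps e.
  by move: good; rewrite (negPf nc) /= => /(edge_geo geoP).
apply/hasPn => st' st'ps; apply/negP => c; apply: (none (geo e.1 e.2)); split=> //.
exists (st'.1 :: geo st'.1 st'.2); first by apply/mapP; exists st'.
by apply: (covers_infix geoP); case: (e) c.
Qed.

Lemma decode_coding ps V : coding W geo ps V ->
  decode V = [seq e.1 :: geo e.1 e.2 | e <- ps].
Proof.
elim: ps V => [|st ps IH] [|c V] //= [<- tr cr /IH ->]; congr (_ :: _).
by rewrite (expand_geo geoP _ tr) // => e /cr; exact: hop_geo.
Qed.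

Lemma answer_coding ps V s t : coding W geo ps V ->
  answer V s t = if (s, t) \in ps then Some (s :: geo s t) else None.
Proof.
move=> /decode_coding; rewrite /answer => ->; case: geoP => _ _ gl _.
elim: ps => //= -[x y] ps IH; rewrite gl inE.
by rewrite -[_ == Some s]/(x == s) xpair_eqE [s == x]eq_sym [t == y]eq_sym;
  case: andP => [[/eqP -> /eqP ->]|_].
Qed.

End Decoding.

(** * Writing codes as bit strings *)

Lemma bit_decoder (T : finType) (x0 : T) b : (#|T| <= 2 ^ b)%N ->
  exists f : bitseq -> T, forall x, exists2 bs, size bs = b & f bs = x.
Proof.
move=> Tb; pose B := map val (enum {: b.-tuple bool}).
have sB : size B = (2 ^ b)%N by rewrite size_map -cardE card_tuple card_bool.
have uB : uniq B by rewrite map_inj_uniq ?enum_uniq //; apply: val_inj.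
exists (fun bs => nth x0 (enum T) (index bs B)) => x.
have iT : (index x (enum T) < size (enum T))%N by rewrite index_mem mem_enum.
have iB : (index x (enum T) < size B)%N by rewrite sB (leq_trans iT) -?cardE.
exists (nth [::] B (index x (enum T))).
  by have /mapP [u _ ->] := mem_nth [::] iB; rewrite size_tuple.
by rewrite index_uniq // nth_index ?mem_enum.
Qed.

Section Serialization.
Variable T : Type.
Implicit Types (V : seq (T * seq T)) (l : seq (option T)).

Definition serialize V : seq (option T) :=
  flatten [seq rcons (map Some (c.1 :: c.2)) None | c <- V].

Definition split_blocks l : seq (seq T) :=
  foldr (fun o acc => if o is Some u then
      if acc is h :: acc' then (u :: h) :: acc' else [:: [:: u]]
    else [::] :: acc) [::] l.

Definition parse l : seq (T * seq T) :=
  pmap (fun q => if q is x :: r then Some (x, r) else None) (split_blocks l).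

(** Each genuine block contains its first node; padding only creates empty blocks, which [parse]
    drops. *)
Lemma serializeK V k : parse (serialize V ++ nseq k None) = V.
Proof.
have block q l : split_blocks (rcons (map Some q) None ++ l) = q :: split_blocks l.
  by rewrite cat_rcons; elim: q => //= y q ->.
elim: V => [|[x r] V IH]; first by rewrite /parse; elim: k.
have -> : serialize ((x, r) :: V) = rcons (map Some (x :: r)) None ++ serialize V by [].
rewrite -catA.
by rewrite /parse block /= -[in RHS]IH.
Qed.

Lemma size_serialize V :
  size (serialize V) = (\sum_(c <- V) size c.2 + 2 * size V)%N.
Proof.
elim: V => [|c V IH]; first by rewrite big_nil.
rewrite /serialize /= size_cat -/(serialize V) IH size_rcons size_map big_cons.
by rewrite mulnS; lia.
Qed.

End Serialization.

Lemma size_coding (R : realType) n W geo ps V :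
  @coding R n W geo ps V -> size V = size ps.
Proof. by elim: ps V => [|st ps IH] [|c V] //= [_ _ _ /IH ->]. Qed.

(** * Comparison of preservers and oracles *)

Section Comparison.
Variables (R : realType) (n p : nat).
Implicit Types (E P : {set 'I_n * 'I_n}) (w : 'I_n * 'I_n -> R).

Let reachable E e : Prop := exists q, is_path E e.1 e.2 q.

Lemma SPO_ok_of_DP_ok k b : (1 < n)%N -> (p <= n * n)%N -> (n < 2 ^ b)%N ->
  DP_ok R n p k -> SPO_ok R n p (b * (8 * k)).
Proof.
move=> n_gt1 pn nb DPk; have pk := DP_ok_ge_pairs n_gt1 pn DPk.
(* The serialized code has at most [(2 * k + p) + 2 * p] symbols, and [p <= 2 * k]. *)
set M := (8 * k)%N.
have [|f fP] := @bit_decoder {: M.-tuple (option 'I_n)} [tuple None | i < M] (b * M).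
  rewrite card_tuple card_option card_ord expnM.
  by have [->|M_gt0] := posnP M; rewrite ?expn0 // leq_exp2r.
exists (fun bs => answer (parse (f bs))) => E w w_ge0 P Pp.
have [W [geo [geoP gE]]] := unique_geodesics_exist w_ge0.
pose ps := [seq e <- enum P | `[< reachable E e >]].
have [V [L [VP LP Lps sL sV]]] := coding_exists geoP ps.
have sps : (size ps <= p)%N by rewrite -Pp cardE size_filter count_size.
have LP' : {subset map (@chain_ends n) L <= P}.
  by move=> e /Lps; rewrite mem_filter mem_enum => /andP [].
have Lk : (\sum_(c <- L) size c.2 <= k)%N.
  by apply: (DP_ok_ge_chains geoP LP LP'); rewrite Pp.
have sM : (size (serialize V) <= M)%N.
  rewrite size_serialize (size_coding VP) /M; move: sV Lk; lia.
pose l := serialize V ++ nseq (M - size (serialize V)) None.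
have sl : size l == M by rewrite size_cat size_nseq subnKC.
have [bs sbs fbs] := fP (Tuple sl); exists bs; rewrite sbs; split=> // s t stP.
rewrite fbs serializeK (answer_coding geoP _ _ VP) mem_filter mem_enum stP andbT.
have [[q qP]|noq] := asboolP (reachable E (s, t)); last first.
  by move=> q; apply/negP => qP; apply: noq; exists q.
have [gP _] := gE s t q qP; split=> //.
by apply/esym/dist_min => // q' /gE [].
Qed.

Lemma DP_ok_of_SPO_ok b : (1 < n)%N -> (p <= n * n)%N ->
  SPO_ok R n p b -> DP_ok R n p (16 * b).
Proof.
move=> n_gt1 pn SPOb; have pb := SPO_ok_ge_pairs n_gt1 pn SPOb.
move=> E w w_ge0 P Pp.
have [W [geo [geoP gE]]] := unique_geodesics_exist w_ge0.
pose ps := [seq e <- enum P | `[< reachable E e >]].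
have [V [L [VP LP Lps sL sV]]] := coding_exists geoP ps.
have sps : (size ps <= p)%N by rewrite -Pp cardE size_filter count_size.
have LP' : {subset map (@chain_ends n) L <= P}.
  by move=> e /Lps; rewrite mem_filter mem_enum => /andP [].
have Lb : (\sum_(c <- L) (size c.2).-1 <= 2 * b)%N.
  by apply: (SPO_ok_ge_chains geoP LP LP'); rewrite Pp.
have sumL : (\sum_(c <- L) size c.2 = \sum_(c <- L) (size c.2).-1 + size L)%N.
  rewrite -sum1_size -big_split /=; apply: eq_big_seq => c cL.
  have [cN _ _] := chain_systemP LP cL.
  by rewrite addn1 prednK // lt0n size_eq0.
pose EH := [set e | has (fun st => e \in edges (st.1 :: geo st.1 st.2)) ps].
have EHE : EH \subset E.
  apply/fintype.subsetP => e; rewrite inE => /hasP [[s t]].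
  rewrite mem_filter => /andP [/asboolP [q /gE [/is_pathP [r [[->] _ _ sub]] _]] _].
  exact: sub.
exists EH; split; last first.
  (* The chains of [L] have at most [2 * b + p] edges, so those of [V] have at most [4 * b + 3 * p],
     and [p <= 4 * b]. *)
  apply: (@leq_trans (size (chain_edges V))); last first.
    rewrite size_chain_edges; move: sV Lb; rewrite sumL; lia.
  apply: leq_trans (card_size _); apply/subset_leq_card/fintype.subsetP => e.
  by rewrite inE => /hasP [st /(coding_edges geoP VP) sub /sub].
split=> // -[s t] stP /=.
have EHpath q : is_path EH s t q -> is_path E s t q.
  case/is_pathP => r [-> u l sub]; apply/is_pathP; exists r; split=> // e /sub.
  exact: (fintype.subsetP EHE).
have [[q qP]|noq] := pselect (reachable E (s, t)).
  have [gP _] := gE s t q qP.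
  have gmin q' : is_path E s t q' -> pweight w (s :: geo s t) <= pweight w q'.
    by move=> /gE [].
  rewrite (dist_min gP gmin); apply: dist_min => [|q' /EHpath/gmin //].
  case/is_pathP: gP => r [[rE] u l sub]; apply/is_pathP; exists r; rewrite rE.
  split=> // e er; rewrite inE; apply/hasP; exists (s, t); last by rewrite /= rE.
  by rewrite mem_filter mem_enum stP andbT; apply/asboolP; exists q.
have [[_ ->]|[q [/EHpath qP _]]] := dist_cases EH w s t; last by case: noq; exists q.
have [[_ ->]|[q [qP _]]] // := dist_cases E w s t; by case: noq; exists q.
Qed.

(** There are only [n * n] pairs, so no demand set has size [p]. *)
Lemma DP_SPO_ok_excess : (n * n < p)%N -> DP_ok R n p 0 /\ SPO_ok R n p 0.
Proof.
move=> np; have noP P : #|P| = p -> False.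
  by move=> Pp; have := max_card P; rewrite Pp card_prod card_ord leqNgt np.
split=> [E w _ P /noP //|].
by exists (fun _ _ _ => None) => E w _ P /noP.
Qed.

End Comparison.

(** For one node [ln n] vanishes, so the upper bound forces an oracle without bits; the one-node
    path is the only simple path. *)
Lemma DP_SPO_ok_singleton (R : realType) p : DP_ok R 1 p 0 /\ SPO_ok R 1 p 0.
Proof.
have path1 (E : {set 'I_1 * 'I_1}) s t q : is_path E s t q = (q == [:: s]).
  apply/is_pathP/eqP => [[r [-> u _ _]]|->].
    by have := uniq_size_le u; case: r {u}.
  exists [::]; split=> //; first by rewrite [s]ord1 [t]ord1.
  by rewrite edges1.
split=> [E w w_ge0 P _|].
  exists finset.set0; rewrite cards0; split=> //; split=> [|st _]; first exact: finset.sub0set.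
  congr ereal_inf; rewrite predeqE => y.
  by split=> -[q qP <-]; exists q => //; move: qP; rewrite /= !path1.
exists (fun _ s _ => Some [:: s]) => E w w_ge0 P _; exists [::]; split=> // s t _.
split; first by rewrite path1.
by apply/esym/dist_min => [|q']; rewrite path1 // => /eqP ->.
Qed.

Lemma least_natP (Q : nat -> Prop) k : Q k -> Q (least_nat Q) /\ (least_nat Q <= k)%N.
Proof.
move=> Qk; rewrite /least_nat; case: pselect => [h|[]]; last by exists k.
case: ex_minnP => m /asboolP Qm mmin; split=> //; apply: mmin; exact/asboolP.
Qed.

Theorem theorem4p7 (R : realType) :
  exists c1 c2 : R, 0 < c1 /\ 0 < c2 /\
    forall n p : nat, (0 < n)%N -> (0 < p)%N ->
      c1 * (DP R n p)%:R <= (SPO R n p)%:R /\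
      (SPO R n p)%:R <= c2 * (DP R n p)%:R * ln (n%:R : R).
Proof.
have ln2 : 0 < ln (2 : R) by rewrite ln_gt0 ?ltr1n.
(* The first 16 is that of [DP_ok_of_SPO_ok]. The second is the 8 of [SPO_ok_of_DP_ok] times 2,
   since [b] is at most twice [trunc_log 2 n]; [ln 2] changes the base. *)
exists 16^-1, (16 / ln 2); split; first by rewrite invr_gt0.
split=> [|n p n_gt0 p_gt0]; first by rewrite divr_gt0.
have zero : DP_ok R n p 0 /\ SPO_ok R n p 0 ->
    16^-1 * (DP R n p)%:R <= (SPO R n p)%:R :> R /\
    (SPO R n p)%:R <= 16 / ln 2 * (DP R n p)%:R * ln (n%:R : R).
  move=> [DP0 SPO0]; have [_ ] := @least_natP (DP_ok R n p) 0 DP0.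
  have [_ ] := @least_natP (SPO_ok R n p) 0 SPO0; rewrite /DP /SPO !leqn0 => /eqP -> /eqP ->.
  by rewrite !mulr0 mul0r.
have [np|pn] := ltnP (n * n) p; first exact/zero/DP_SPO_ok_excess.
have [n_gt1|] := ltnP 1 n; last first.
  rewrite leq_eqVlt ltnNge n_gt0 orbF => /eqP nE.
  by apply: zero; rewrite nE; apply: DP_SPO_ok_singleton.
have DPn : DP_ok R n p (n * n).
  move=> E w _ P _; exists E; split; first by split.
  by have := max_card E; rewrite card_prod card_ord.
have [DPmin _] := @least_natP (DP_ok R n p) _ DPn; rewrite -/(DP R n p) in DPmin.
(* With [b] bits one can tell apart [n.+1] symbols, the nodes and the separator [None]. *)
set b := (trunc_log 2 n).+1.
have nb : (n < 2 ^ b)%N by rewrite trunc_log_ltn.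
have [SPOmin SPOle] :=
  @least_natP (SPO_ok R n p) _ (SPO_ok_of_DP_ok n_gt1 pn nb DPmin).
rewrite -/(SPO R n p) in SPOmin SPOle.
have [_ DPle] :=
  @least_natP (DP_ok R n p) _ (DP_ok_of_SPO_ok n_gt1 pn SPOmin).
rewrite -/(DP R n p) in DPle; split.
  by rewrite ler_pdivrMl // -natrM ler_nat.
have logn : (trunc_log 2 n)%:R * ln 2 <= ln (n%:R : R).
  rewrite mulr_natl -lnXn ?ltr0n // -natrX ler_ln ?posrE ?ltr0n ?expn_gt0 //.
  by rewrite ler_nat trunc_logP.
have log_gt0 : (0 < trunc_log 2 n)%N by rewrite trunc_log_gt0.
apply: (@le_trans _ _ (16 * (trunc_log 2 n)%:R * (DP R n p)%:R)).
  rewrite -!natrM ler_nat; apply: (leq_trans SPOle).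
  by rewrite mulnA leq_mul2r; apply/orP; right; rewrite /b; lia.
rewrite [leRHS]mulrAC ler_wpM2r ?ler0n // -!mulrA ler_pM2l //.
by rewrite mulrC ler_pdivlMr.
Qed.
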